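(* For every finite simple graph $G$ of maximum degree $\Delta$, $$\chi_o(G)\le \left\lfloor \frac{3\Delta}{2}\right\rfloor+2 .$$
   Context: All graphs are finite, undirected and simple. An odd colouring of a graph $G$ is a proper vertex-colouring $\sigma$ of $G$ such that for every non-isolated vertex $v$ there is a colour that appears an odd number of times on the (open) neighbourhood $N_G(v)$. The odd chromatic number $\chi_o(G)$ is the minimum integer $k$ such that $G$ has an odd colouring $\sigma\colon V(G)\to\{1,\dots,k\}$. *)

(* Defs.v *)
From mathcomp Require Import all_boot.

Set Implicit Arguments.
Unset Strict Implicit.
Unset Printing Implicit Defensive.

Record sgraph := SGraph {
  vertex :> finType;
  adj : rel vertex;
  adj_sym : symmetric adj;
  adj_irr : irreflexive adj
}.
Arguments adj {s} x y.

Definition neighbours (G : sgraph) (v : G) : {set G} := [set w | adj v w].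

Definition max_degree (G : sgraph) : nat := \max_(v : G) #|neighbours v|.

Definition proper (G : sgraph) (C : finType) (c : {ffun G -> C}) : bool :=
  [forall x : G, forall y : G, adj x y ==> (c x != c y)].

Definition odd_colouring (G : sgraph) (C : finType) (c : {ffun G -> C}) : bool :=
  proper c &&
  [forall v : G, (neighbours v != set0) ==>
     [exists a : C, odd #|[set w in neighbours v | c w == a]|]].

Definition odd_colourable (G : sgraph) (k : nat) : bool :=
  [exists c : {ffun G -> 'I_k}, odd_colouring c].

(* Giving all vertices distinct colours is an odd colouring, so the minimum
   defining the odd chromatic number is over a nonempty set. *)
Lemma odd_colourable_ex (G : sgraph) : exists k, odd_colourable G k.
Proof.
exists #|G|; apply/existsP; exists [ffun x => enum_rank x]; apply/andP; split.
  apply/forallP=> x; apply/forallP=> y; apply/implyP=> xy; rewrite !ffunE.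
  by apply: contraTneq xy => /enum_rank_inj->; rewrite adj_irr.
apply/forallP=> v; apply/implyP=> /set0Pn[w vw]; apply/existsP.
exists (enum_rank w); rewrite (_ : [set _ | _] = [set w]) ?cards1 //.
apply/setP=> u; rewrite !inE ffunE (inj_eq enum_rank_inj) andbC.
by case: eqP => // ->; move: vw; rewrite inE.
Qed.

Definition odd_chromatic_number (G : sgraph) : nat :=
  ex_minn (odd_colourable_ex G).

(* Main.v *)
Require Import Defs.
From mathcomp Require Import all_boot.
From mathcomp Require Import zify.

(** The colouring is built one vertex at a time.  A partial colouring is kept
    proper and odd in a strong sense: every vertex of the graph that has a
    coloured neighbour, whether or not it is coloured itself, sees some colour
    an odd number of times.

    An uncoloured vertex v may take any colour outside its forbidden set, made
    of the colours of its neighbours x and of the colours that are the only odd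
    colour around such an x ([extend_colouring]).  This can amount to twice the
    degree of v, so v may be blocked.  When it is, the forbidden colours are so
    many, compared with the number of neighbours, that some neighbour w has a
    sole odd colour around it and carries a colour b that is forbidden to v by
    w only ([blocked_neighbour]).  The colour b is then moved from w to v, and
    w is coloured anew.  Now w has few forbidden colours: around w all colours
    but one occur an even number of times, so the deg w - 1 neighbours other
    than v carry at most deg w / 2 colours between them ([sole_odd_colours]).
    Adding b, now on v, and one sole odd colour for each neighbour, at most
    3 deg w / 2 + 1 colours are forbidden to w, and one is left.  The vertices
    adjacent to both v and w do not notice the move of b, those adjacent to v
    only do not have b as sole odd colour, and those adjacent to w are taken
    care of by the new colour of w. *)

Set Implicit Arguments.
Unset Strict Implicit.
Unset Printing Implicit Defensive.

Definition class (G : sgraph) (C : finType) (f : G -> option C) (x : G) (a : C) :=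
  [set y in neighbours x | f y == Some a].

Definition odd_at (G : sgraph) (C : finType) (f : G -> option C) (x : G) (a : C) :=
  odd #|class f x a|.

Definition sole_odd (G : sgraph) (C : finType) (f : G -> option C) (x : G) (a : C) :=
  [forall b, odd_at f x b == (b == a)].

Definition sole_odd_of (G : sgraph) (C : finType) (f : G -> option C) (x : G) :=
  [pick a | sole_odd f x a].

(** A new [a] next to [x] would leave no odd colour around [x] exactly when [a]
    is the sole odd colour there. *)
Definition forbidden (G : sgraph) (C : finType) (f : G -> option C) (v : G) :=
  [set a | [exists x, adj v x && ((f x == Some a) || sole_odd f x a)]].

Definition partial_proper (G : sgraph) (C : finType) (f : G -> option C) :=
  forall x y a, adj x y -> f x = Some a -> f y <> Some a.

(** The vertex [x] need not be coloured: a vertex that receives its colour late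
    has then an odd colour around it already. *)
Definition sees_odd (G : sgraph) (C : finType) (f : G -> option C) (x : G) :=
  (exists2 y, adj x y & f y != None) -> exists a, odd_at f x a.

Definition recolour (G : sgraph) (C : finType) (f : G -> option C) (u : G)
  (o : option C) : G -> option C := fun x => if x == u then o else f x.

Lemma sole_odd_ofE (G : sgraph) (C : finType) (f : G -> option C) x a :
  sole_odd f x a -> sole_odd_of f x = Some a.
Proof.
move=> xa; rewrite /sole_odd_of; case: pickP => [b xb|/(_ a)]; last by rewrite xa.
move/forallP: xa => /(_ a)/eqP; move/forallP: xb => /(_ a)/eqP->.
by rewrite eqxx => /eqP->.
Qed.

Lemma odd_at_recolour (G : sgraph) (C : finType) (f : G -> option C) u o x a :
  odd_at (recolour f u o) x a =
  odd_at f x a (+) (adj x u && ((f u == Some a) (+) (o == Some a))).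
Proof.
rewrite /odd_at (cardsD1 u) (cardsD1 u (class f x a)) !oddD !oddb.
have -> : class (recolour f u o) x a :\ u = class f x a :\ u.
  by apply/setP => y; rewrite !inE /recolour; case: eqP.
rewrite !inE /recolour eqxx; set p := odd _.
by case: (adj x u); case: (f u == _); case: (o == _); case: p.
Qed.

Lemma not_sole_odd (G : sgraph) (C : finType) (f : G -> option C) x a :
  ~~ sole_odd f x a -> exists b, odd_at f x b (+) (b == a).
Proof. by move=> /forallPn[b]; exists b; rewrite -negb_eqb. Qed.

Lemma proper_recolour (G : sgraph) (C : finType) (f : G -> option C) u a :
    partial_proper f -> (forall y, adj u y -> f y <> Some a) ->
  partial_proper (recolour f u (Some a)).
Proof.
move=> fP ua x y b; rewrite /recolour.
case: (x =P u) => [->|_]; case: (y =P u) => [->|_] xy.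
- by rewrite adj_irr in xy.
- by case=> <-; apply: ua.
- by move=> fx [ab]; apply: (ua x); rewrite 1?adj_sym // fx ab.
- exact: fP xy.
Qed.

(** A neighbour of [u] is safe whatever it saw before: unless [a] is its sole odd
    colour, adding one more [a] around it cannot make all parities even.  This
    is why the parity condition is only asked of [f] away from [u], which lets
    one uncolour [u] first and repair the damage by its new colour. *)
Lemma extend_colouring (G : sgraph) (C : finType) (f : G -> option C) u a :
    partial_proper f -> f u = None ->
    (forall x, ~~ adj x u -> sees_odd f x) -> a \notin forbidden f u ->
  let g := recolour f u (Some a) in
  partial_proper g /\ forall x, sees_odd g x.
Proof.
move=> fP fu fo; rewrite inE => /existsPn au; split.
  apply: proper_recolour => // y uy fy; have := au y.
  by rewrite uy fy eqxx.
move=> x; case: (boolP (adj x u)) => xu.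
  have /norP[_ /not_sole_odd[b xb]] : ~~ ((f x == Some a) || sole_odd f x a).
    by have := au x; rewrite adj_sym xu.
  by exists b; rewrite odd_at_recolour xu fu /= eq_sym.
case=> y xy gy; case: (fo x xu) => [|b xb]; last first.
  by exists b; rewrite odd_at_recolour (negPf xu) addbF.
exists y => //; move: gy; rewrite /recolour; case: (y =P u) => // yu _.
by rewrite -yu xy in xu.
Qed.

Lemma Some_inj (T : Type) : injective (@Some T).
Proof. by move=> ? ? []. Qed.

Lemma card_partial_image (T C : finType) (h : T -> option C) (A : {set T}) :
  #|[set a | Some a \in h @: A]| <= #|A|.
Proof.
rewrite -(card_imset _ (@Some_inj C)); apply: leq_trans (leq_imset_card h A).
apply: subset_leq_card; apply/subsetP => _ /imsetP[a + ->].
by rewrite inE.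
Qed.

Lemma sum_class (G : sgraph) (C : finType) (f : G -> option C) v (B : {set C}) :
  \sum_(b in B) #|class f v b| <= #|[set y in neighbours v | f y != None]|.
Proof.
under eq_bigr => b _ do rewrite -sum1dep_card big_mkcond /=.
rewrite exchange_big -sum1dep_card [leqRHS]big_mkcond /=; apply: leq_sum => y _.
rewrite inE; case: (adj v y) => /=; last by rewrite big1.
case: (f y) => [c|] /=; last by rewrite big1.
rewrite -big_mkcondr sum1dep_card -(cards1 c); apply: subset_leq_card.
by apply/subsetP => b; rewrite !inE => /andP[_ /eqP[->]].
Qed.

(** The colours around [w] other than [a] occur an even number of times, hence
    at least twice each.  The uncoloured neighbour [v] leaves deg w - 1 coloured
    ones, and this compensates for the single occurrence that [a] may have. *)
Lemma sole_odd_colours (G : sgraph) (C : finType) (f : G -> option C) v w a :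
    sole_odd f w a -> adj w v -> f v = None ->
  2 * #|[set b | class f w b != set0]| <= #|neighbours w|.
Proof.
move=> /forallP wa wv fv; set T := [set b | _].
have lt_w : #|[set y in neighbours w | f y != None]| < #|neighbours w|.
  apply: proper_card; apply/properP; split.
    by apply/subsetP => y; rewrite inE => /andP[].
  by exists v; rewrite !inE wv // fv.
suff le_T : 2 * #|T| <= \sum_(b in T) #|class f w b| + 1.
  by have := sum_class f w T; lia.
have le_a : \sum_(b in T) (b == a) <= 1.
  rewrite -big_mkcondr sum1dep_card -(cards1 a); apply: subset_leq_card.
  by apply/subsetP => b; rewrite !inE => /andP[_].
rewrite mulnC -sum_nat_const; apply: leq_trans (leq_add (leqnn _) le_a).
rewrite -big_split; apply: leq_sum => b; rewrite inE -card_gt0.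
by have := wa b; rewrite /odd_at; case: (b == a); case: #|_| => [|[]].
Qed.

Lemma card_forbidden (G : sgraph) (C : finType) (f : G -> option C) w :
  #|forbidden f w| <= #|[set b | class f w b != set0]| + #|neighbours w|.
Proof.
set S := [set a | Some a \in sole_odd_of f @: neighbours w].
have le_S : #|S| <= #|neighbours w| := card_partial_image _ _.
apply: leq_trans (leq_add (leqnn _) le_S).
apply: leq_trans (leq_card_setU _ _); apply: subset_leq_card.
apply/subsetP => a; rewrite !inE => /existsP[x /andP[wx]].
case/orP => [fx|xa]; apply/orP; [left | right].
  by apply/set0Pn; exists x; rewrite !inE wx.
by apply/imsetP; exists x; rewrite ?inE // (sole_odd_ofE xa).
Qed.

(** To each neighbour of [v] attach its sole odd colour, or its own colour if
    there is none.  At least #|C| - deg v colours are attached to no neighbour.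
    They are forbidden all the same, so each of them is the colour of some
    neighbour, which has a sole odd colour.  If each were carried by two
    neighbours, then 2 (#|C| - deg v) <= deg v would follow, against the
    assumption.  So some [b] among them is carried by a single [w]. *)
Lemma blocked_neighbour (G : sgraph) (C : finType) (f : G -> option C) v :
    3 * #|neighbours v| < 2 * #|C| -> forbidden f v = setT ->
  exists w a b, [/\ adj v w, sole_odd f w a, f w = Some b,
    forall x, adj v x -> f x = Some b -> x = w &
    forall x, adj v x -> ~~ sole_odd f x b].
Proof.
move=> ltC full; set N := neighbours v.
pose h x := if sole_odd_of f x is Some a then Some a else f x.
pose A := [set a | Some a \in h @: N].
have leA : #|A| <= #|N| := card_partial_image _ _.
have AB : #|A| + #|~: A| = #|C| := cardsC A.
have notA x b : b \in ~: A -> adj v x -> h x <> Some b.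
  rewrite !inE => bA vx hx; case/imsetP: bA; exists x => //.
  by rewrite inE.
have soleB x b : b \in ~: A -> adj v x -> ~~ sole_odd f x b.
  by move=> bA vx; apply/negP => /sole_odd_ofE xb; apply: (notA x b); rewrite /h ?xb.
have classB b : b \in ~: A -> 0 < #|class f v b|.
  move=> bA; have : b \in forbidden f v by rewrite full inE.
  rewrite inE => /existsP[x /andP[vx /orP[fx|xb]]].
    by apply/card_gt0P; exists x; rewrite !inE vx.
  by rewrite (negPf (soleB x b bA vx)) in xb.
have [b bA /cards1P[w bw]] : exists2 b, b \in ~: A & #|class f v b| == 1.
  apply/exists_inP; apply: contraLR ltC => /exists_inPn one.
  have le2 : 2 * #|~: A| <= \sum_(b in ~: A) #|class f v b|.
    rewrite mulnC -sum_nat_const; apply: leq_sum => b bA.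
    by have := classB b bA; have := one b bA; case: #|_| => [|[]].
  have leN : #|[set y in N | f y != None]| <= #|N|.
    by apply: subset_leq_card; apply/subsetP => y; rewrite inE => /andP[].
  have := sum_class f v (~: A); rewrite -/N; lia.
have /[!inE]/andP[vw /eqP fw] : w \in class f v b by rewrite bw set11.
have : h w <> Some b by exact: notA.
rewrite /h /sole_odd_of; case: pickP => [a wa _|//].
exists w, a, b; split => // x vx; last exact: soleB.
by move=> fx; apply/set1P; rewrite -bw !inE vx fx /=.
Qed.

(** A blocked [v] takes over the colour [b] of the neighbour [w] given by
    [blocked_neighbour], and [w] is coloured anew. *)
Lemma grow_colouring (G : sgraph) (C : finType) (f : G -> option C) v :
    3 * max_degree G + 2 < 2 * #|C| ->
    partial_proper f -> (forall x, sees_odd f x) -> f v = None ->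
  exists g : G -> option C, [/\ partial_proper g, forall x, sees_odd g x,
    forall x, f x != None -> g x != None & g v != None].
Proof.
move=> ltC fP fo fv.
have degG (x : G) : #|neighbours x| <= max_degree G.
  exact: (leq_bigmax (F := fun x : G => #|neighbours x|)).
have [full|] := eqVneq (forbidden f v) setT; last first.
  rewrite -properT => /properP[_ [a _ av]].
  have [gP go] := extend_colouring fP fv (fun x _ => fo x) av.
  exists (recolour f v (Some a)); split => // [x|]; rewrite /recolour ?eqxx //.
  by case: (x =P v).
have [|w [a [b [vw wa fw onlyw notb]]]] := blocked_neighbour _ full.
  by have := degG v; lia.
have wv : w != v by apply: contraTneq vw => ->; rewrite adj_irr.
(* [g] is the stage where [v] already has [b] and [w] awaits its new colour. *)
pose g := recolour (recolour f w None) v (Some b).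
have gw : g w = None by rewrite /g /recolour (negPf wv) eqxx.
have gP : partial_proper g.
  apply: proper_recolour => [x y c xy|y vy].
    by rewrite /recolour; case: (x =P w) => // _; case: (y =P w) => // _; apply: fP.
  by rewrite /recolour; case: (y =P w) => // yw /(onlyw y vy).
have go x : ~~ adj x w -> sees_odd g x.
  move=> xw; have odd_g c : odd_at g x c = odd_at f x c (+) (adj x v && (c == b)).
    rewrite !odd_at_recolour (negPf xw) addbF /recolour [v == w]eq_sym (negPf wv) fv.
    by rewrite [c == b]eq_sym.
  (* Next to [v], the parities are those of [f] after one more [b], and [b] was
     not the sole odd colour there; elsewhere they are those of [f]. *)
  case: (boolP (adj x v)) odd_g => xv odd_g.
    have /notb/not_sole_odd[c xc] : adj v x by rewrite adj_sym.
    by exists c; rewrite odd_g.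
  case=> y xy gy; case: (fo x) => [|c xc]; last by exists c; rewrite odd_g addbF.
  exists y => //; move: gy; rewrite /g /recolour.
  by case: (y =P v) => [yv|_]; [rewrite -yv xy in xv | case: (y =P w)].
have lt_w : #|forbidden g w| < #|C|.
  have sub : [set c | class g w c != set0] \subset b |: [set c | class f w c != set0].
    apply/subsetP => c; rewrite !inE => /set0Pn[y]; rewrite !inE /g /recolour.
    case: (y =P v) => [_ /andP[_ /eqP[->]]|_]; first by rewrite eqxx.
    case: (y =P w) => [_ /andP[]//|_ wy]; apply/orP; right; apply/set0Pn.
    by exists y; rewrite !inE.
  have := sole_odd_colours wa _ fv; rewrite adj_sym => /(_ vw).
  have := card_forbidden g w; have := subset_leq_card sub.
  have := degG w; rewrite cardsU1; case: (b \notin _); lia.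
have /subsetPn[c _ cw] : ~~ ([set: C] \subset forbidden g w).
  by apply: contraL lt_w => /subset_leq_card; rewrite cardsT -leqNgt.
have [kP ko] := extend_colouring gP gw go cw.
exists (recolour g w (Some c)); split => // [x|]; rewrite /g /recolour.
  by case: (x =P w) => // _; case: (x =P v).
by case: (v =P w); rewrite ?eqxx.
Qed.

Lemma full_colouring (G : sgraph) (C : finType) :
    3 * max_degree G + 2 < 2 * #|C| ->
  exists f : G -> option C, [/\ partial_proper f, forall x, sees_odd f x &
    forall x, f x != None].
Proof.
move=> ltC.
suff grow n (f : G -> option C) :
    partial_proper f -> (forall x, sees_odd f x) -> #|[set x | f x == None]| < n ->
    exists g : G -> option C, [/\ partial_proper g, forall x, sees_odd g x &
      forall x, g x != None].
  by apply: (grow #|G|.+1 (fun=> None)) => // [x []|]; rewrite ?ltnS ?max_card.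
elim: n f => [|n IHn] f fP fo //.
have [f0 _ | [v]] := set_0Vmem [set x | f x == None].
  exists f; split => // x.
  by have := in_set0 x; rewrite -f0 inE => ->.
rewrite inE ltnS => /eqP fv le_f; have [g [gP go gf gv]] := grow_colouring ltC fP fo fv.
apply: (IHn g) => //; apply: leq_trans le_f; apply: proper_card.
apply/properP; split; last by exists v; rewrite inE ?fv.
by apply/subsetP => x; rewrite !inE; apply: contraTT; apply: gf.
Qed.

Theorem theorem1p4 (G : sgraph) :
  odd_chromatic_number G <= (3 * max_degree G) %/ 2 + 2.
Proof.
rewrite /odd_chromatic_number; case: ex_minnP => k _; apply; rewrite addn2.
set D := _ %/ 2.
have [|f [fP fo f1]] := @full_colouring G 'I_D.+2; first by rewrite card_ord /D; lia.
pose c := [ffun x => odflt ord0 (f x)]; have cE x : f x = Some (c x).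
  by rewrite ffunE; case: (f x) (f1 x).
apply/existsP; exists c; apply/andP; split.
  apply/forallP => x; apply/forallP => y; apply/implyP => xy; apply/eqP => cxy.
  by apply: (fP x y (c x)) => //; rewrite cE // cxy.
apply/forallP => v; apply/implyP => /set0Pn[w]; rewrite inE => vw.
case: (fo v) => [|a va]; first by exists w.
apply/existsP; exists a; move: va; rewrite /odd_at; congr (odd #|pred_of_set _|).
by apply/setP => y; rewrite !inE cE.
Qed.
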